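(* Let $C(m)=\frac1{m+1}\binom{2m}{m}$ denote the Catalan number. For $1\le m\le n$, the dimensions of the homogeneous components of $B_{\infty,2}$ are given by: (i) $\mathsf b_{\infty,2}(n,m)=\#\mathcal{SP}(n,m)=C(m)\binom{n+m}{n-m}$; (ii) $\mathsf b_{\infty,2}(n,* )=2\cdot\#\mathcal{PT}(n)$, which are the large Schr\''oder numbers; (iii) $\mathsf b_{\infty,2}( *,m)$ is infinite.
   Context: \textbf{Decorated trees.} In a rooted planar tree, a node is a leaf if it has no children and internal otherwise; an angle is the sector between two consecutive children of an internal node. $\mathcal T_{\infty,2}$ is the set of finite rooted planar trees with at least one internal node, with each angle labeled by a positive integer and each internal node labeled by $0$ or $1$, such that: every internal node has at least two children; among the children of each node only the leftmost and rightmost can be leaves; only the root may have label $0$ (all other internal nodes have label $1$). $\deg_{\mathrm{node}}(t)$ is the sum of the internal node labels of $t$ and $\deg_{\mathrm{angle}}(t)$ the sum of its angle labels. $\mathcal T_{\infty,2}(n,m)$ is the set of $t\in\mathcal T_{\infty,2}$ with $\deg_{\mathrm{angle}}(t)=n$ and $\deg_{\mathrm{node}}(t)=m$. $B_{\infty,2}$ is the free $\Bbbk$-module on $\mathcal T_{\infty,2}$ ($\Bbbk$ a commutative ring), and $B_{\infty,2}(n,m)$ the submodule with basis $\mathcal T_{\infty,2}(n,m)$; $B_{\infty,2}(n,* )=\bigoplus_{m\ge0}B_{\infty,2}(n,m)$, $B_{\infty,2}( *,m)=\bigoplus_{n\ge1}B_{\infty,2}(n,m)$. $\mathsf b_{\infty,2}(n,m)$,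 $\mathsf b_{\infty,2}(n,* )$, $\mathsf b_{\infty,2}( *,m)$ denote the dimensions (ranks, i.e. numbers of basis trees) of these. ($B_{\infty,2}$ underlies the free Baxter algebra on one generator with a quasi-idempotent operator.) \textbf{Planar trees and paths.} $\mathcal{PT}(n)$ is the set of (undecorated) rooted planar trees with $n+1$ leaves, all of whose internal nodes have at least two children. $\mathcal{SP}(n,m)$ is the set of lattice paths from $(0,0)$ to $(n,n)$ with steps $H=(1,0)$, $V=(0,1)$, $D=(1,1)$, never rising above the diagonal $y=x$ (Schr\''oder paths), with exactly $n-m$ steps $D$. The large Schr\''oder number is the number of all Schr\''oder paths from $(0,0)$ to $(n,n)$. *)

(* Defs.v *)
From HB Require Import structures.
From mathcomp Require Import all_boot all_order all_algebra.
From mathcomp Require Import boolp classical_sets functions cardinality.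
From mathcomp Require Import monalg.

Set Implicit Arguments.
Unset Strict Implicit.
Unset Printing Implicit Defensive.

Import GRing.Theory.

Local Open Scope classical_set_scope.
Local Open Scope card_scope.

(* Finite rooted planar trees whose internal nodes carry a decoration in A.
   The list gives the children from left to right; [Node a [::]] is excluded by
   the well-formedness conditions below. *)
Inductive ptree (A : Type) : Type :=
| Leaf
| Node of A & seq (ptree A).

Arguments Leaf {A}.

Fixpoint ptree_encode (A : Type) (t : ptree A) : GenTree.tree A :=
  match t with
  | Leaf => GenTree.Node 0 [::]
  | Node a ts => GenTree.Node 1 (GenTree.Leaf a :: map (@ptree_encode A) ts)
  end.

Fixpoint ptree_decode (A : Type) (g : GenTree.tree A) : ptree A :=
  match g with
  | GenTree.Node 1 (GenTree.Leaf a :: gs) => Node a (map (@ptree_decode A) gs)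
  | _ => Leaf
  end.

Lemma ptree_encodeK (A : Type) : cancel (@ptree_encode A) (@ptree_decode A).
Proof.
rewrite /cancel; fix IH 1 => -[|a ts] //=; congr Node.
by elim: ts => [|t ts IHts] //=; rewrite IH IHts.
Qed.

HB.instance Definition _ (A : eqType) :=
  Equality.copy (ptree A) (can_type (@ptree_encodeK A)).
HB.instance Definition _ (A : choiceType) :=
  Choice.copy (ptree A) (can_type (@ptree_encodeK A)).

Definition is_leaf (A : Type) (t : ptree A) : bool :=
  if t is Leaf then true else false.

Fixpoint nleaves (A : Type) (t : ptree A) : nat :=
  match t with
  | Leaf => 1
  | Node _ ts => sumn (map (@nleaves A) ts)
  end.

Fixpoint arity_ge2 (A : Type) (t : ptree A) : bool :=
  match t with
  | Leaf => true
  | Node _ ts => (1 < size ts) && all (@arity_ge2 A) ts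
  end.

Definition PT (n : nat) : set (ptree unit) :=
  [set t | arity_ge2 t /\ nleaves t = n.+1].

(* The decoration of an internal node is its label, [false] for 0 and [true]
   for 1, together with the labels of its angles from left to right. *)
Definition dtree := ptree (bool * seq nat).

(* The children of a node other than the leftmost and the rightmost one. *)
Definition middle (A : Type) (ts : seq A) : seq A :=
  behead (take (size ts).-1 ts).

(* Conditions on one internal node; [root] tells whether it is the root. *)
Definition node_ok (root : bool) (d : bool * seq nat) (ts : seq dtree) : bool :=
  [&& 1 < size ts,
      size d.2 == (size ts).-1,
      all (leq 1) d.2,
      all (fun t => ~~ is_leaf t) (middle ts)
    & root || d.1].

Fixpoint nodes_ok (root : bool) (t : dtree) : bool :=
  match t with
  | Leaf => true
  | Node d ts => node_ok root d ts && all (nodes_ok false) ts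
  end.

Definition Tinf2_pred (t : dtree) : bool := ~~ is_leaf t && nodes_ok true t.

Definition Tinf2 := {t : dtree | Tinf2_pred t}.

Fixpoint dtree_deg_node (t : dtree) : nat :=
  match t with
  | Leaf => 0
  | Node d ts => d.1 + sumn (map dtree_deg_node ts)
  end.

Fixpoint dtree_deg_angle (t : dtree) : nat :=
  match t with
  | Leaf => 0
  | Node d ts => sumn d.2 + sumn (map dtree_deg_angle ts)
  end.

Definition deg_node (t : Tinf2) : nat := dtree_deg_node (val t).
Definition deg_angle (t : Tinf2) : nat := dtree_deg_angle (val t).

Definition Tinf2_hom (n m : nat) : set Tinf2 :=
  [set t | deg_angle t = n /\ deg_node t = m].

Section Modules.
Local Open Scope ring_scope.
Variables (k : comNzRingType) (M : lmodType k).

Definition lspan (S : set M) : set M :=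
  [set x | exists (p : nat) (c : 'I_p -> k) (v : 'I_p -> M),
     (forall i, S (v i)) /\ x = \sum_(i < p) c i *: v i].

Definition lfree (S : set M) : Prop :=
  forall (p : nat) (c : 'I_p -> k) (v : 'I_p -> M),
    (forall i, S (v i)) -> injective v ->
    \sum_(i < p) c i *: v i = 0 -> forall i, c i = 0.

Definition is_basis (E N : set M) : Prop := lfree E /\ lspan E = N.

(* Over a nonzero commutative ring any two bases of a module are equipotent,
   so the rank may be read off from one of them. *)
Definition has_rank (N : set M) (r : nat) : Prop :=
  exists E : set M, is_basis E N /\ E #= `I_r.

Definition has_infinite_rank (N : set M) : Prop :=
  exists E : set M, is_basis E N /\ infinite_set E.

End Modules.

Section Binf2.
Local Open Scope ring_scope.
Variable k : comNzRingType.

(* [{malg k[T]}] is the free k-module of finitely supported functions T -> k;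
   its basis vector at t is [<< t >>]. *)
Definition Binf2 : lmodType k := {malg k[Tinf2]}.

Definition Binf2_basis (t : Tinf2) : Binf2 := << t >>.

Definition Binf2_hom (n m : nat) : set Binf2 :=
  lspan (Binf2_basis @` Tinf2_hom n m).

(* Internal direct sums: the sum of a family of submodules is the span of their
   union, and it is direct here because the [Binf2_hom n m] are spanned by
   pairwise disjoint sets of basis vectors. *)
Definition Binf2_angle (n : nat) : set Binf2 :=
  lspan (\bigcup_(m in [set: nat]) Binf2_hom n m).

Definition Binf2_node (m : nat) : set Binf2 :=
  lspan (\bigcup_(n in [set n | (1 <= n)%N]) Binf2_hom n m).

End Binf2.

Inductive step : Set := stepH | stepV | stepD.

Definition step_dx (s : step) : nat := if s is stepV then 0 else 1.
Definition step_dy (s : step) : nat := if s is stepH then 0 else 1.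
Definition is_stepD (s : step) : bool := if s is stepD then true else false.

(* Coordinates of the endpoint of a path starting at (0,0). *)
Definition path_x (p : seq step) : nat := sumn (map step_dx p).
Definition path_y (p : seq step) : nat := sumn (map step_dy p).

Definition schroder_path (n : nat) : set (seq step) :=
  [set p | path_x p = n /\ path_y p = n /\
           forall i, path_y (take i p) <= path_x (take i p)].

Definition SP (n m : nat) : set (seq step) :=
  [set p | schroder_path n p /\ count is_stepD p = n - m].

(* N is the n-th large Schroder number. *)
Definition large_schroder (n N : nat) : Prop := schroder_path n #= `I_N.

(* The division is exact. *)
Definition catalan (m : nat) : nat := 'C(2 * m, m) %/ m.+1.

(* Main.v *)
Require Import Defs.
From HB Require Import structures.
From mathcomp Require Import all_boot all_order all_algebra.
From mathcomp Require Import boolp classical_sets functions cardinality.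
From mathcomp Require Import finmap monalg zify ring.

(** The three families of objects are matched by degree-preserving bijections,
    and one of them is counted.

    In a tree of T_(oo,2) only the outermost children of a node may be leaves.
    Replacing the label a of an angle by a - 1 leaves inserted in that angle
    ([spread]) is therefore reversible ([collect]): the interior leaves of the
    resulting planar tree are exactly the inserted ones, and the angle degree n
    becomes the number of leaves minus one. Apart from the root, all node labels
    are 1, so a decorated tree amounts to a root label together with a planar
    tree in PT(n) ([coding_inj], [coding_image]). This gives twice the
    cardinality of PT(n).

    A root label b and a planar tree u are next viewed as a nonempty forest: u
    itself if b = 1, the subtrees at the root of u if b = 0. A forest is a
    sequence of trees, a Schroeder path is a sequence, separated by the D steps
    on the diagonal, of pieces without such steps, and a nonempty piece of this
    kind is H, a Schroeder path, V and another piece, just as a node that is not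
    a leaf is its leftmost child together with the nonempty forest of the other
    ones. So forests and paths correspond ([forest_path_inj],
    [forest_path_surj]); the H steps correspond to the internal nodes of the
    forest, whose number is the node degree of the decorated tree. Hence
    [image_hom]: the trees of degrees (n, m) are matched with SP(n, m).

    Finally the paths with m steps H, m steps V and n - m steps D are listed by
    [words] and counted by a ballot formula ([size_words], [size_words_diag]).

    For modules, a family of basis trees is free and its span has the
    cardinality of the family as rank ([Binf2_rank]). The part of node degree
    m has infinite rank because, for each n >= m, SP(n, m) is not empty, so that
    there is a tree of degrees (n, m). *)

Set Implicit Arguments.
Unset Strict Implicit.
Unset Printing Implicit Defensive.

Import GRing.Theory.

Local Open Scope classical_set_scope.
Local Open Scope card_scope.

(** * Decorated trees as planar trees *)

(** The induction principle that the nested recursion of the trees calls for: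
    the hypothesis is available at every child. *)
Lemma ptree_seq_ind (A : eqType) (P : ptree A -> Prop) :
  P Leaf ->
  (forall a ts, {in ts, forall t, P t} -> P (Node a ts)) ->
  forall t, P t.
Proof.
move=> P_leaf P_node; fix IH 1 => -[|a ts]; [exact: P_leaf | apply: P_node].
elim: ts => [|t ts IHts] u; first (rewrite in_nil => u_nil; discriminate u_nil).
rewrite inE => /orP[/eqP->|]; [exact: IH | exact: IHts].
Qed.

Lemma is_leafE (A : Type) (t : ptree A) : is_leaf t -> t = Leaf.
Proof. by case: t. Qed.

(** Only the leftmost and the rightmost child of a node of a decorated tree can
    be leaves, so a label a on an angle can be stored without ambiguity as a - 1
    new leaves put inside that angle. Here [ts] lists the children other than
    the leftmost one, each preceded by the angle to its left. *)
Fixpoint expand (A : Type) (angles : seq nat) (ts : seq (ptree A)) :=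
  match angles, ts with
  | a :: angles', t :: ts' => nseq a.-1 Leaf ++ t :: expand angles' ts'
  | _, _ => [::]
  end.

(** The inverse of [expand]; the accumulator is one more than the number of
    leaves absorbed since the last child kept. A leaf at the end of the list is
    kept: it is the rightmost child. *)
Fixpoint contract (A : Type) (a : nat) (ts : seq (ptree A)) :
    seq (nat * ptree A) :=
  match ts with
  | [::] => [::]
  | t :: ts' => if is_leaf t && ~~ nilp ts' then contract a.+1 ts'
                else (a, t) :: contract 1 ts'
  end.

Lemma contract_nseq (A : Type) a k (ts : seq (ptree A)) :
  ~~ nilp ts -> contract a (nseq k Leaf ++ ts) = contract (a + k) ts.
Proof.
move=> ts0; elim: k a => [|k IHk] a /=; first by rewrite addn0.
by rewrite /nilp size_cat -/(nilp _) addn_eq0 negb_and ts0 orbT IHk addSnnS.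
Qed.

Lemma expandK (A : Type) angles (ts : seq (ptree A)) :
  size angles = size ts -> all (leq 1) angles ->
  all (fun t => ~~ is_leaf t) (take (size ts).-1 ts) ->
  contract 1 (expand angles ts) = zip angles ts.
Proof.
elim: angles ts => [|a angles IH] [|t ts] //= [sz] /andP[a0 angles0] nl.
rewrite contract_nseq //= add1n prednK //.
have -> : is_leaf t && ~~ nilp (expand angles ts) = false.
  case: ts sz nl => [|u us]; first by case: (angles) => //; rewrite andbF.
  by move=> _ /= /andP[/negbTE->].
congr (_ :: _); apply: IH => //; case: ts sz nl => //= u us _.
by case/andP.
Qed.

Lemma contractK (A : Type) a (ts : seq (ptree A)) : 0 < a -> ~~ nilp ts ->
  expand (unzip1 (contract a ts)) (unzip2 (contract a ts)) =
  nseq a.-1 Leaf ++ ts.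
Proof.
elim: ts a => //= t ts IH a a0 _; case: ifP => [/andP[/is_leafE-> ts0]|_ /=].
  (* The absorbed leaf comes back as the last of the a new ones. *)
  by rewrite IH // -{1}(prednK a0) /= -cat_rcons -cats1 -(nseqD _ 1) addn1.
by congr (_ ++ _ :: _); case: ts IH => // u us ->.
Qed.

Lemma map_expand (A B : Type) (f : ptree A -> ptree B) angles ts :
  f Leaf = Leaf -> map f (expand angles ts) = expand angles (map f ts).
Proof.
move=> fL; elim: angles ts => [|a angles IH] [|t ts] //=.
by rewrite map_cat map_nseq fL /= IH.
Qed.

Lemma all_expand (A : Type) (P : pred (ptree A)) angles ts :
  P Leaf -> size angles = size ts -> all P (expand angles ts) = all P ts.
Proof.
move=> PL; elim: angles ts => [|a angles IH] [|t ts] //= [sz].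
by rewrite all_cat all_nseq PL orbT /= IH.
Qed.

Lemma nilp_expand (A : Type) angles (ts : seq (ptree A)) :
  size angles = size ts -> nilp (expand angles ts) = nilp ts.
Proof.
by case: angles ts => [|a angles] [|t ts] //= _; rewrite /nilp size_cat addnS.
Qed.

(** Each angle labelled a contributes a - 1 leaves; the equation avoids the
    subtraction. With f = [nleaves] it converts angle labels into leaves, with
    f = [internal] it shows that the new leaves are invisible. *)
Lemma sumn_expand (A : Type) (f : ptree A -> nat) angles ts :
  size angles = size ts -> all (leq 1) angles ->
  sumn (map f (expand angles ts)) + size ts * f Leaf =
  sumn angles * f Leaf + sumn (map f ts).
Proof.
elim: angles ts => [|a angles IH] [|t ts] //= [sz] /andP[a0 /(IH _ sz)].
rewrite map_cat map_nseq sumn_cat sumn_nseq /= => E.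
by case: a a0 => //= a _; rewrite !mulSn !mulnDl ?mulSn; lia.
Qed.

Section Contract.
Variable A : Type.
Implicit Types (a : nat) (ts : seq (ptree A)).

Lemma nilp_contract a ts : nilp (contract a ts) = nilp ts.
Proof.
elim: ts a => //= t ts IH a; case: ifP => // /andP[_ ts0].
by rewrite IH; apply/negbTE.
Qed.

Lemma contract_pos a ts : 0 < a -> all (leq 1) (unzip1 (contract a ts)).
Proof.
elim: ts a => //= t ts IH a a0; case: ifP => _ /=; first exact: IH.
by rewrite a0 IH.
Qed.

Lemma all_contract (P : pred (ptree A)) a ts :
  all P ts -> all P (unzip2 (contract a ts)).
Proof.
elim: ts a => //= t ts IH a /andP[Pt Pts].
by case: ifP => _ /=; rewrite ?Pt IH.
Qed.

Lemma contract_nonleaf a ts :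
  all (fun t => ~~ is_leaf t) (take (size (contract a ts)).-1
    (unzip2 (contract a ts))).
Proof.
elim: ts a => //= t ts IH a; case: ifP => //= /negbT; rewrite negb_and negbK.
have := IH 1; have := nilp_contract 1 ts.
case: (contract 1 ts) => [|[b u] c] //= ts0.
by rewrite -ts0 orbF => -> ->.
Qed.

End Contract.

(** A node whose angle labels have sum s ends up with s + 1 children; hence the
    angle degree n becomes n + 1 leaves. *)
Fixpoint spread (t : dtree) : ptree unit :=
  match t with
  | Leaf => Leaf
  | Node d ts =>
      Node tt (match map spread ts with
               | [::] => [::]
               | u :: us => u :: expand d.2 us
               end)
  end.

(** The inverse of [spread], choosing the label 1 at every node; a node
    without children, excluded by [arity_ge2], is sent to a leaf. *)
Fixpoint collect (t : ptree unit) : dtree :=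
  match t with
  | Leaf => Leaf
  | Node _ ts =>
      match map collect ts with
      | [::] => Leaf
      | u :: us => let c := contract 1 us in
                   Node (true, unzip1 c) (u :: unzip2 c)
      end
  end.

Definition root_label (t : dtree) : bool := if t is Node d _ then d.1 else true.

(** The other labels being 1, the root label is the only information that
    [spread] loses. *)
Definition relabel (b : bool) (t : dtree) : dtree :=
  if t is Node d ts then Node (b, d.2) ts else Leaf.

Lemma relabelK b t : relabel (root_label t) (relabel b t) = t.
Proof. by case: t => //= -[]. Qed.

Lemma node_okP r d ts : node_ok r d ts ->
  exists u us, [/\ ts = u :: us, ~~ nilp us, size d.2 = size us,
    all (leq 1) d.2 & all (fun t => ~~ is_leaf t) (take (size us).-1 us)] /\
    (r || d.1).
Proof.
case: ts => [|u us] /and5P[] //= sz1 /eqP sz pos nl lab.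
exists u, us; split => //; split => //; first by case: us sz1 {sz nl}.
by case: us sz1 {sz} nl.
Qed.

Lemma node_ok_cons r d u us : ~~ nilp us -> size d.2 = size us ->
  all (leq 1) d.2 -> all (fun t => ~~ is_leaf t) (take (size us).-1 us) ->
  r || d.1 -> node_ok r d (u :: us).
Proof.
move=> us0 sz pos nl lab; apply/and5P; split => //=; first by case: us us0 {sz nl}.
- exact/eqP.
- by case: us us0 {sz} nl.
Qed.

Lemma relabel_ok b t : nodes_ok false t -> nodes_ok true (relabel b t).
Proof.
by case: t => //= d ts /andP[/and5P[? ? ? ? _] ->]; rewrite andbT; apply/and5P.
Qed.

Lemma spreadK r t : nodes_ok r t -> collect (spread t) = relabel true t.
Proof.
elim/ptree_seq_ind: t r => [|d ts IH] r /=; first by [].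
move=> /andP[/node_okP].
case=> u [us [[Ets us0 sz pos nl] _]]; rewrite {}Ets in IH * => oks.
have fIH : {in u :: us, collect \o spread =1 id}.
  move=> v vin /=; have okv := allP oks _ vin; rewrite (IH _ vin _ okv).
  case: v {vin} okv => //= -[b angles] vs /andP[/and5P[_ _ _ _]] /=.
  by move=> ->.
rewrite /= map_expand // -map_comp -[collect (spread u)]/((collect \o spread) u).
rewrite fIH ?mem_head //.
have -> : map (collect \o spread) us = us.
  by rewrite -[RHS]map_id; apply/eq_in_map => v vin; rewrite fIH // inE vin orbT.
by rewrite expandK // unzip1_zip ?sz // unzip2_zip ?sz.
Qed.

Lemma arity_ge2P a (ts : seq (ptree unit)) : arity_ge2 (Node a ts) ->
  exists u us, [/\ ts = u :: us, ~~ nilp us & all (@arity_ge2 unit) ts].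
Proof. by case: ts => [|u [|v vs]] //= oks; exists u, (v :: vs). Qed.

Lemma collectK t : arity_ge2 t -> spread (collect t) = t.
Proof.
elim/ptree_seq_ind: t => // -[] ts IH /arity_ge2P [u [us [Ets us0 oks]]].
have fIH : {in ts, spread \o collect =1 id}.
  by move=> v vin; apply: IH => //; apply: (allP oks).
rewrite Ets /= -map_expand // contractK //=; last by case: (us) us0.
rewrite -[spread (collect u)]/((spread \o collect) u) -map_comp.
rewrite fIH ?Ets ?mem_head //; congr (Node _ (_ :: _)).
by rewrite -[RHS]map_id; apply/eq_in_map => v vin; rewrite fIH // Ets inE vin orbT.
Qed.

Lemma collect_ok t : arity_ge2 t -> nodes_ok false (collect t).
Proof.
elim/ptree_seq_ind: t => // -[] ts IH /arity_ge2P [u [us [Ets us0 oks]]].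
have cok : {in ts, forall v, nodes_ok false (collect v)}.
  by move=> v vin; apply: IH => //; apply: (allP oks).
rewrite Ets /=; apply/andP; split; last first.
  rewrite /= cok ?Ets ?mem_head //= all_contract // all_map.
  by apply/allP => v vin; apply: cok; rewrite Ets inE vin orbT.
apply: node_ok_cons => //=.
- by rewrite /nilp size_map -/(nilp _) nilp_contract; case: (us) us0.
- by rewrite !size_map.
- exact: contract_pos.
- by rewrite size_map contract_nonleaf.
Qed.

Lemma spread_arity r t : nodes_ok r t -> arity_ge2 (spread t).
Proof.
elim/ptree_seq_ind: t r => [|d ts IH] r /=; first by [].
move=> /andP[/node_okP].
case=> u [us [[Ets us0 sz pos nl] _]]; rewrite {}Ets in IH * => oks.
have aIH : {in u :: us, forall v, arity_ge2 (spread v)}.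
  by move=> v vin; apply: (IH _ vin false); apply: (allP oks).
have sz' : size d.2 = size (map spread us) by rewrite size_map.
rewrite /= all_expand // all_map aIH ?mem_head //=; apply/andP; split.
  by rewrite ltnS lt0n -/(nilp _) nilp_expand // /nilp size_map.
by apply/allP => v vin; apply: aIH; rewrite inE vin orbT.
Qed.

Lemma nleaves_spread r t :
  nodes_ok r t -> nleaves (spread t) = (dtree_deg_angle t).+1.
Proof.
elim/ptree_seq_ind: t r => [|d ts IH] r /=; first by [].
move=> /andP[/node_okP].
case=> u [us [[Ets us0 sz pos nl] _]]; rewrite {}Ets in IH * => oks.
have aIH : {in u :: us, forall v, nleaves (spread v) = (dtree_deg_angle v).+1}.
  by move=> v vin; apply: (IH _ vin false); apply: (allP oks).
have sz' : size d.2 = size (map spread us) by rewrite size_map.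
have := sumn_expand (@nleaves unit) sz' pos.
rewrite /= aIH ?mem_head // size_map !muln1 -map_comp.
have -> : sumn (map (@nleaves unit \o spread) us) =
          sumn (map dtree_deg_angle us) + size us.
  elim: (us) aIH => //= v vs IHv aIH; rewrite aIH ?inE ?eqxx ?orbT // IHv; first lia.
  move=> w; rewrite inE => win; apply: aIH.
  by rewrite !inE; case/orP: win => ->; rewrite ?orbT.
by lia.
Qed.

Fixpoint internal (A : Type) (t : ptree A) : nat :=
  match t with
  | Leaf => 0
  | Node _ ts => (sumn (map (@internal A) ts)).+1
  end.

Definition children (A : Type) (t : ptree A) : seq (ptree A) :=
  if t is Node _ ts then ts else [::].

Lemma sumn_children r d (ts : seq dtree) : node_ok r d ts ->
  {in ts, forall v, internal (spread v) = dtree_deg_node v} ->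
  sumn (map (@internal unit) (children (spread (Node d ts)))) =
  sumn (map dtree_deg_node ts).
Proof.
case/node_okP => u [us [[-> us0 sz pos nl] _]] E.
have sz' : size d.2 = size (map spread us) by rewrite size_map.
have := sumn_expand (@internal unit) sz' pos; rewrite !muln0 addn0 add0n /=.
rewrite E ?mem_head // => ->; rewrite -map_comp; congr (_ + sumn _).
by apply/eq_in_map => v vin; apply: E; rewrite inE vin orbT.
Qed.

(** Below the root every node has label 1, so labels add up to the number of
    internal nodes. *)
Lemma internal_spread t :
  nodes_ok false t -> internal (spread t) = dtree_deg_node t.
Proof.
elim/ptree_seq_ind: t => // d ts IH /= /andP[ok oks].
have := sumn_children ok; rewrite /= => ->; last first.
  by move=> v vin; apply: IH => //; apply: (allP oks).
by case/and5P: ok => _ _ _ _ /= ->.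
Qed.

(** A pair consisting of a root label and a planar tree is a forest: the tree
    alone for the label 1, the two or more subtrees of its root for the label 0.
    Removing the root in the second case makes the number of internal nodes of
    the forest equal to the sum of the node labels. *)
Definition forest (bu : bool * ptree unit) : seq (ptree unit) :=
  if bu.1 then [:: bu.2] else children bu.2.

Lemma internal_forest t : Tinf2_pred t ->
  sumn (map (@internal unit) (forest (root_label t, spread t))) =
  dtree_deg_node t.
Proof.
case: t => // d ts /andP[_ /andP[ok /allP oks]].
have E := sumn_children ok (fun v vin => internal_spread (oks v vin)).
rewrite [RHS]/= -E /forest /=; case: d.1 => //=.
by rewrite addn0.
Qed.

(** * Forests as Schroeder paths *)

(** The starting point lies h units below the diagonal. The recursion on the
    first step replaces the quantification over prefixes ([belowP]). *)
Fixpoint below (h : nat) (p : seq step) : bool :=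
  match p with
  | [::] => true
  | stepH :: p' => below h.+1 p'
  | stepV :: p' => (0 < h) && below h.-1 p'
  | stepD :: p' => below h p'
  end.

Lemma belowP h p :
  (forall i, path_y (take i p) <= h + path_x (take i p)) <-> below h p.
Proof.
elim: p h => [|s p IH] h; first by split.
suff step_iff : (forall i, path_y (take i (s :: p)) <=
                           h + path_x (take i (s :: p))) <->
  step_dy s <= h + step_dx s /\
  (forall i, path_y (take i p) <= h + step_dx s - step_dy s + path_x (take i p)).
  rewrite step_iff IH; case: s {step_iff} => /=.
  - by rewrite addn1 subn0; split=> [[]|->].
  - by rewrite addn0 subn1; split=> [[-> ->]|/andP].
  - by rewrite addnK; split=> [[]|->] //; rewrite addn1.
split=> [le|[le0 le] [|i]] //.
  have le0 : step_dy s <= h + step_dx s.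
    by have := le 1; rewrite /path_x /path_y /= take0 /= !addn0.
  split=> // i; have := le i.+1; rewrite /path_x /path_y /=; lia.
by have := le i; rewrite /path_x /path_y /=; lia.
Qed.

Lemma path_x_cat p q : path_x (p ++ q) = path_x p + path_x q.
Proof. by rewrite /path_x map_cat sumn_cat. Qed.

Lemma path_y_cat p q : path_y (p ++ q) = path_y p + path_y q.
Proof. by rewrite /path_y map_cat sumn_cat. Qed.

Definition join (ps : seq (seq step)) : seq step :=
  if ps is p :: ps' then p ++ flatten (map (cons stepD) ps') else [::].

(** A node with children t, t1, ..., tr gives H p1 D p2 D ... D pr V p, where p
    and the pi are the paths of t and the ti. Thus the pairs H, V correspond to
    the internal nodes, a node with r + 1 children accounts for r steps H or D,
    and no D lies on the starting diagonal of a tree, which makes the D steps of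
    [join] recognizable. *)
Fixpoint tree_path (t : ptree unit) : seq step :=
  match t with
  | Leaf => [::]
  | Node _ ts => match map tree_path ts with
                 | [::] => [::]
                 | p :: ps => stepH :: join ps ++ stepV :: p
                 end
  end.

Definition forest_path (ts : seq (ptree unit)) : seq step :=
  join (map tree_path ts).

Lemma forest_path_cons t ts : ~~ nilp ts ->
  forest_path (t :: ts) = tree_path t ++ stepD :: forest_path ts.
Proof. by case: ts. Qed.

Lemma tree_path_node a t ts :
  tree_path (Node a (t :: ts)) = stepH :: forest_path ts ++ stepV :: tree_path t.
Proof. by []. Qed.

(** The paths of trees are balanced and never rise above the diagonal on which
    they start, so they can be erased without affecting [below]. *)
Lemma below_forest ts h s :
  {in ts, forall t h s, below h (tree_path t ++ s) = below h s} ->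
  below h (forest_path ts ++ s) = below h s.
Proof.
elim: ts => // t ts IH bel; case ts0: (nilp ts).
  by case: ts {IH} ts0 bel => // _ bel; rewrite /forest_path /= cats0 bel ?mem_head.
rewrite forest_path_cons ?ts0 // -catA bel ?mem_head //=; apply: IH => u uin.
by apply: bel; rewrite inE uin orbT.
Qed.

Lemma below_tree t h s : below h (tree_path t ++ s) = below h s.
Proof.
elim/ptree_seq_ind: t h s => // a [|t ts] IH h s //.
rewrite tree_path_node cat_cons -catA cat_cons /= below_forest /=.
  by rewrite IH ?mem_head.
by move=> u uin; apply: IH; rewrite inE uin orbT.
Qed.

Lemma forest_path_size_in ts : ~~ nilp ts ->
  {in ts, forall t, [/\ (path_x (tree_path t)).+1 = nleaves t,
     (path_y (tree_path t)).+1 = nleaves t &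
     count is_stepD (tree_path t) + internal t = path_x (tree_path t)]} ->
  [/\ (path_x (forest_path ts)).+1 = sumn (map (@nleaves unit) ts),
      (path_y (forest_path ts)).+1 = sumn (map (@nleaves unit) ts) &
      count is_stepD (forest_path ts) + sumn (map (@internal unit) ts) =
      path_x (forest_path ts)].
Proof.
elim: ts => // t ts IH _ H; have [x y d] := H t (mem_head _ _).
case ts0: (nilp ts).
  by case: ts {IH} ts0 H => // _ _; rewrite /forest_path /= cats0 !addn0.
have {}IH := IH (negbT ts0); case: IH => [u uin|x' y' d'].
  by apply: H; rewrite inE uin orbT.
rewrite forest_path_cons ?ts0 // path_x_cat path_y_cat count_cat /=.
by rewrite /path_x /path_y /= in x y d x' y' d' *; split; lia.
Qed.

Lemma tree_path_size t : arity_ge2 t ->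
  [/\ (path_x (tree_path t)).+1 = nleaves t,
     (path_y (tree_path t)).+1 = nleaves t &
     count is_stepD (tree_path t) + internal t = path_x (tree_path t)].
Proof.
elim/ptree_seq_ind: t => [|a ts IH]; first by [].
move=> /arity_ge2P [u [us [Ets us0 oks]]].
have {}IH : {in ts, forall t, [/\ (path_x (tree_path t)).+1 = nleaves t,
     (path_y (tree_path t)).+1 = nleaves t &
     count is_stepD (tree_path t) + internal t = path_x (tree_path t)]}.
  by move=> v vin; apply: IH => //; apply: (allP oks).
rewrite {}Ets {oks} in IH *; have [x y d] := IH u (mem_head _ _).
case: (forest_path_size_in us0) => [v vin|x' y' d'].
  by apply: IH; rewrite inE vin orbT.
rewrite tree_path_node -cat_cons path_x_cat path_y_cat count_cat /=.
by rewrite /path_x /path_y /= in x y d x' y' d' *; split; lia.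
Qed.

Lemma forest_path_size ts : ~~ nilp ts -> all (@arity_ge2 unit) ts ->
  [/\ (path_x (forest_path ts)).+1 = sumn (map (@nleaves unit) ts),
      (path_y (forest_path ts)).+1 = sumn (map (@nleaves unit) ts) &
      count is_stepD (forest_path ts) + sumn (map (@internal unit) ts) =
      path_x (forest_path ts)].
Proof.
by move=> ts0 /allP oks; apply: forest_path_size_in => // t /oks /tree_path_size.
Qed.

Definition no_H (p : seq step) : bool := if p is stepH :: _ then false else true.

(** Unique readability of the path of a tree as an initial piece of a word. The
    continuation must not start with H, since H would be read as the beginning
    of a node where the tree has a leaf. *)
Definition parses_uniquely (t : ptree unit) : Prop :=
  forall t' s s', arity_ge2 t' -> no_H s -> no_H s' ->
  tree_path t ++ s = tree_path t' ++ s' -> t = t' /\ s = s'.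

(** After the path of a tree, the next step D or V tells whether the forest goes
    on. *)
Lemma forest_path_parse_unique ts ts' s s' : {in ts, forall t, parses_uniquely t} ->
  ~~ nilp ts -> ~~ nilp ts' -> all (@arity_ge2 unit) ts' ->
  forest_path ts ++ stepV :: s = forest_path ts' ++ stepV :: s' ->
  ts = ts' /\ s = s'.
Proof.
elim: ts ts' => // t ts IH [|t' ts'] //= P _ _ /andP[ok' oks'].
have Pt := P t (mem_head _ _).
have Pts : {in ts, forall t, parses_uniquely t}.
  by move=> u uin; apply: P; rewrite inE uin orbT.
case ts0: (nilp ts); case ts0': (nilp ts').
- case: ts ts' {IH P Pts oks'} ts0 ts0' => [|//] [|//] _ _.
  by rewrite /forest_path /= !cats0 => /(Pt t') [] // -> [->].
- case: ts {IH P Pts} ts0 => // _; rewrite (forest_path_cons _ (negbT ts0')).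
  by rewrite /forest_path /= !cats0 -catA => /(Pt t') [].
- case: ts' {oks'} ts0' => // _; rewrite (forest_path_cons _ (negbT ts0)).
  by rewrite /forest_path /= !cats0 -catA => /(Pt t') [].
- rewrite !forest_path_cons ?ts0 ?ts0' // -!catA => /(Pt t') [] // -> [].
  by move=> /IH [] //; rewrite ?ts0 ?ts0' // => -> ->.
Qed.

Lemma tree_path_parse_unique t : arity_ge2 t -> parses_uniquely t.
Proof.
elim/ptree_seq_ind: t => [|[] ts IH].
  move=> _ [|[] ts'] s s'; first by [].
  by move=> /arity_ge2P[u [us [-> _ _]]]; case: s => [|[]].
move=> /arity_ge2P [u [us [Ets us0 /allP oks]]].
have {}IH : {in ts, forall v, parses_uniquely v} by move=> v vin; apply/IH/oks.
rewrite {}Ets {oks} in IH * => -[|[] ts'] s s'; first by case: s' => [|[]].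
move=> /arity_ge2P[u' [us' [-> us0' /andP[ok oks]]]] nH nH'.
rewrite !tree_path_node !cat_cons -!catA => -[] /forest_path_parse_unique [] //.
  by move=> v vin; apply: IH; rewrite inE vin orbT.
by move=> -> /(IH u (mem_head _ _)) [] // -> ->.
Qed.

(** Appending a step V to both paths provides the end marker of
    [forest_path_parse_unique]. *)
Lemma forest_path_inj ts ts' :
  ~~ nilp ts -> ~~ nilp ts' ->
  all (@arity_ge2 unit) ts -> all (@arity_ge2 unit) ts' ->
  forest_path ts = forest_path ts' -> ts = ts'.
Proof.
move=> ts0 ts0' /allP oks oks' E.
suff [] : ts = ts' /\ [::] = [::] :> seq step by [].
apply: forest_path_parse_unique => //; last by rewrite E.
by move=> t /oks /tree_path_parse_unique.
Qed.

(** Greedy parsing. It never gets stuck because x <= y: after an H and a forest,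
    whose path is balanced, the remaining word must contain more V than H, hence
    is not empty, hence starts with the V that closes the node. *)
Lemma parse_exists p : path_x p <= path_y p ->
  (exists t s, [/\ arity_ge2 t, p = tree_path t ++ s & no_H s]) /\
  (exists ts s, [/\ ~~ nilp ts, all (@arity_ge2 unit) ts,
     p = forest_path ts ++ s & (s = [::] \/ exists s', s = stepV :: s')]).
Proof.
have [k] := ubnP (size p); elim: k p => // k IH p /ltnSE le_k xy.
have [t [s [okt Ep nHs]]] :
    exists t s, [/\ arity_ge2 t, p = tree_path t ++ s & no_H s].
  case: p le_k xy => [|[] p] le_k xy; try by exists Leaf; eexists.
  have [|_ [ts [s [ts0 oks Ep]]]] := IH p le_k; first exact: ltnW.
  have E : ~~ nilp ts -> path_x (forest_path ts) = path_y (forest_path ts).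
    by case/forest_path_size/(_ oks) => x y _; apply: succn_inj; rewrite x y.
  move: xy; rewrite Ep -cat_cons path_x_cat path_y_cat /path_x /path_y /=.
  rewrite -/(path_x _) -/(path_y _) (E ts0) => xy [Es|[s' Es]].
    by move: xy; rewrite Es /=; lia.
  have [||[t [s'' [okt Es' nH]]] _] := IH s'.
  - by move: le_k; rewrite Ep Es /= size_cat /=; lia.
  - by move: xy; rewrite Es /path_x /path_y /=; lia.
  exists (Node tt (t :: ts)), s''; split => //=.
    by rewrite okt oks; case: (ts) ts0.
  by rewrite Es Es' -catA.
split; first by exists t, s.
case: s Ep nHs => [|[] s] Ep _ //.
- exists [:: t], [::]; split; rewrite /= ?okt //; last by left.
  by rewrite /forest_path /= cats0.
- exists [:: t], (stepV :: s); split; rewrite /= ?okt //; last by right; exists s.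
  by rewrite /forest_path /= cats0.
have [x y _] := tree_path_size okt.
have [||_ [ts [s' [ts0 oks Es Hs']]]] := IH s.
- by move: le_k; rewrite Ep size_cat /=; lia.
- move: xy; rewrite Ep path_x_cat path_y_cat; move: x y.
  by rewrite /path_x /path_y /=; lia.
exists (t :: ts), s'; split; rewrite /= ?okt //.
by rewrite forest_path_cons // Ep Es -catA.
Qed.

Lemma schroder_pathE n p :
  schroder_path n p <-> [/\ path_x p = n, path_y p = n & below 0 p].
Proof.
rewrite /schroder_path /=.
by split=> [[x [y /(belowP 0)]]|[x y /belowP bel]].
Qed.

Lemma forest_path_schroder n ts : ~~ nilp ts -> all (@arity_ge2 unit) ts ->
  sumn (map (@nleaves unit) ts) = n.+1 -> schroder_path n (forest_path ts).
Proof.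
move=> ts0 oks E; have [x y _] := forest_path_size ts0 oks.
apply/schroder_pathE; split; [lia | lia |].
by rewrite -[forest_path ts]cats0 below_forest // => t _ h s; apply: below_tree.
Qed.

(** The remainder left by [parse_exists] would start with a step V leaving the
    diagonal upwards, which a Schroeder path never does. *)
Lemma forest_path_surj n p : schroder_path n p ->
  exists ts, [/\ ~~ nilp ts, all (@arity_ge2 unit) ts,
    sumn (map (@nleaves unit) ts) = n.+1 & p = forest_path ts].
Proof.
move/schroder_pathE => [x y bel].
have [|_ [ts [s [ts0 oks Ep Hs]]]] := @parse_exists p; first by rewrite x y.
have [x' _ _] := forest_path_size ts0 oks.
case: Hs Ep => [->|[s' ->] Ep].
  by rewrite cats0 => Ep; exists ts; split; rewrite -?Ep // -x' -Ep x.
move: bel; rewrite Ep below_forest //= => t _ h r; exact: below_tree.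
Qed.

(** * Counting Schroeder paths *)

Definition step_code (s : step) : option bool :=
  match s with stepH => Some true | stepV => Some false | stepD => None end.

Definition step_decode (c : option bool) : step :=
  match c with Some true => stepH | Some false => stepV | None => stepD end.

Lemma step_codeK : cancel step_code step_decode. Proof. by case. Qed.

HB.instance Definition _ := Equality.copy step (can_type step_codeK).
HB.instance Definition _ := Choice.copy step (can_type step_codeK).

(** The words of length k = h + v + d with h letters H, v letters V and d
    letters D that complete a path starting v - h units below the diagonal; for
    h > v it would start above the diagonal and there is none. *)
Fixpoint words (k h v d : nat) : seq (seq step) :=
  match k with
  | 0 => [:: [::]]
  | k'.+1 =>
      if h <= v then
        map (cons stepH) (if h is h'.+1 then words k' h' v d else [::]) ++
        map (cons stepV) (if v is v'.+1 then words k' h v' d else [::]) ++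
        map (cons stepD) (if d is d'.+1 then words k' h v d' else [::])
      else [::]
  end.

Lemma mem_map_cons (T : eqType) (x y : T) s ss :
  (x :: s \in map (cons y) ss) = (x == y) && (s \in ss).
Proof.
apply/mapP/andP => [[s' ? [-> ->]] | [/eqP-> ?]]; first by rewrite eqxx.
by exists s.
Qed.

Lemma nil_map_cons (T : eqType) (y : T) ss : ([::] \in map (cons y) ss) = false.
Proof. by apply/mapP => -[]. Qed.

Lemma count_stepD_le p : count is_stepD p <= path_x p.
Proof. by elim: p => // -[] p IH; rewrite /path_x /= in IH *; lia. Qed.

Lemma mem_words k h v d p : k = h + v + d ->
  (p \in words k h v d) = [&& h <= v, path_x p == h + d, path_y p == v + d,
     count is_stepD p == d & below (v - h) p].
Proof.
elim: k h v d p => [|k IH] h v d p E.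
  have [-> -> ->] : [/\ h = 0, v = 0 & d = 0] by split; lia.
  by case: p => [|[] p]; rewrite inE //= /path_x /path_y /= ?andbF.
rewrite /=; case: (leqP h v) => [hv|hv] /=; last by rewrite in_nil.
rewrite !mem_cat; case: p => [|s p].
  by rewrite !nil_map_cons; case: h v d E {hv} => [|h] [|v] [|d].
have -> : path_x (s :: p) = step_dx s + path_x p by [].
have -> : path_y (s :: p) = step_dy s + path_y p by [].
rewrite !mem_map_cons; case: s => /=; rewrite ?orbF.
- case: h E hv => [|h] E hv.
    apply/esym/negP => /and4P[/eqP xd _ /eqP cd _].
    by have := count_stepD_le p; lia.
  by rewrite IH /=; [rewrite (ltnW hv) /= subnSK // addSn eqSS | lia].
- case: v E hv => [|v] E hv; first by rewrite /= !andbF.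
  rewrite IH /=; last lia.
  rewrite subn_gt0 ltnS; case: (leqP h v) => [hv'|_]; last by rewrite !andbF.
  by rewrite subSn //= addSn eqSS.
- case: d E => [|d] E; first by rewrite /= !andbF.
  by rewrite IH /=; [rewrite hv !addnS !eqSS | lia].
Qed.

Lemma words_uniq k h v d : uniq (words k h v d).
Proof.
have cons_inj (s : step) : injective (cons s) by move=> p q [].
elim: k h v d => [|k IH] h v d //=; case: ifP => // _.
rewrite !cat_uniq !(map_inj_uniq (cons_inj _)); apply/and5P; split.
- by case: (h).
- apply/hasPn => q; rewrite mem_cat.
  by case/orP => /mapP[p _ ->]; rewrite /= mem_map_cons.
- by case: (v).
- by apply/hasPn => q /mapP[p _ ->]; rewrite /= mem_map_cons.
- by case: (d).
Qed.

(** The ballot formula with d extra letters D inserted anywhere, cleared of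
    denominators. It is also true, with both sides equal to 0, on the forbidden
    line h = v + 1; with this boundary value the recursion of [words] becomes
    the identity h(v+2-h) + (v+1)(v-h) + d(v+1-h) = (v+1-h)(h+v+d). *)
Lemma size_words k h v d : k = h + v + d -> h <= v.+1 ->
  size (words k h v d) * (v.+1`! * h`! * d`!) = (v.+1 - h) * k`!.
Proof.
elim: k h v d => [|k IH] h v d E hv.
  have [-> -> ->] : [/\ h = 0, v = 0 & d = 0] by split; lia.
  by [].
rewrite [words _ _ _ _]/=; case: leqP => [{}hv|vh]; last first.
  by rewrite (_ : v.+1 - h = 0) //; lia.
rewrite !size_cat !size_map mulnDl [X in _ + X]mulnDl.
have -> : size (if h is h'.+1 then words k h' v d else [::]) * (v.+1`! * h`! * d`!) =
    h * (v.+2 - h) * k`!.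
  case: h E hv => [|h] E hv //=.
  rewrite (factS h) subSS -[RHS]mulnA -(IH h v d); [|lia..].
  set x := h`!; set y := d`!; set z := v.+1`!; set w := size _; ring.
have -> : size (if v is v'.+1 then words k h v' d else [::]) * (v.+1`! * h`! * d`!) =
    v.+1 * (v - h) * k`!.
  case: v E hv => [|v] E hv /=; first by rewrite sub0n muln0.
  rewrite (factS v.+1) -[RHS]mulnA -(IH h v d); [|lia..].
  set x := h`!; set y := d`!; set z := v.+1`!; set w := size _; ring.
have -> : size (if d is d'.+1 then words k h v d' else [::]) * (v.+1`! * h`! * d`!) =
    d * (v.+1 - h) * k`!.
  case: d E => [|d] E //=; rewrite (factS d) -[RHS]mulnA -(IH h v d); [|lia..].
  set x := h`!; set y := d`!; set z := v.+1`!; set w := size _; ring.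
rewrite -!mulnDl factS mulnA; congr (_ * _); rewrite E.
have {hv E} [e ->] : exists e, v = h + e by exists (v - h); lia.
by rewrite -!addnS !addKn; ring.
Qed.

(** The case d = 0 shows that the number of Dyck paths is the Catalan number,
    and in particular that its defining division is exact; the general case is
    then this number times the choices of the places of the D steps. *)
Lemma size_words_diag m d :
  size (words (m + m + d) m m d) = catalan m * 'C(d + 2 * m, d).
Proof.
have size_diag c : size (words (m + m + c) m m c) * m.+1 =
    'C(2 * m, m) * 'C(c + 2 * m, c).
  have pos : 0 < m`! * m`! * c`! by rewrite !muln_gt0 !fact_gt0.
  apply/eqP; rewrite -(eqn_pmul2r pos); apply/eqP.
  have := @size_words (m + m + c) m m c erefl (leqnSn m).
  rewrite subSnn mul1n factS => E.
  have Cm : 'C(2 * m, m) * (m`! * m`!) = (2 * m)`!.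
    by rewrite -(@bin_fact (2 * m) m) mul2n -addnn ?leq_addr // addnK.
  have Cc : 'C(c + 2 * m, c) * (c`! * (2 * m)`!) = (m + m + c)`!.
    rewrite (_ : m + m + c = c + 2 * m); last lia.
    by rewrite -(@bin_fact (c + 2 * m) c) ?leq_addr // addKn.
  rewrite -Cm in Cc; rewrite -Cc in E; move: E {Cm Cc pos}.
  set x := m`!; set y := c`!; set z := size _.
  set u := 'C(2 * m, m); set w := 'C(c + 2 * m, c).
  have -> : z * (m.+1 * x * x * y) = z * m.+1 * (x * x * y) by ring.
  by move=> ->; ring.
have E0 := size_diag 0; rewrite bin0 muln1 in E0.
rewrite /catalan -E0 mulnK //; apply/eqP.
by rewrite -(@eqn_pmul2r m.+1) // size_diag -E0; apply/eqP; ring.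
Qed.

(** * Cardinalities *)

Lemma mem_SP n m p : m <= n ->
  SP n m p <-> p \in words (m + m + (n - m)) m m (n - m).
Proof.
move=> le_mn; rewrite /SP /= schroder_pathE mem_words // leqnn subnn subnKC //=.
by split=> [[[-> -> ->] ->]|/and4P[/eqP ? /eqP ? /eqP ? ?]]; rewrite ?eqxx.
Qed.

Lemma SP_card n m : m <= n ->
  SP n m #= `I_(size (words (m + m + (n - m)) m m (n - m))).
Proof.
move=> le_mn; set ws := words _ _ _ _.
have -> : SP n m = [set` [fset p in ws]%fset].
  by apply/seteqP; split=> p /=; rewrite mem_SP // !inE.
apply/card_eq_fsetP; rewrite card_fseq undup_id //; exact: words_uniq.
Qed.

Lemma schroder_finite n : finite_set (schroder_path n).
Proof.
apply: (@sub_finite_set _ _ (\bigcup_(m in `I_n.+1) SP n m)); last first.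
  apply: bigcup_finite; first exact: finite_II.
  move=> m le_mn; rewrite -/(_ <= _) in le_mn.
  by apply/finite_setP; eexists; apply: SP_card.
move=> p Sp; have := count_stepD_le p; have [x y _] := (schroder_pathE n p).1 Sp.
rewrite x => le_n; exists (n - count is_stepD p); first by rewrite /= ltnS leq_subr.
by split; rewrite // subKn.
Qed.

Definition coding (t : Tinf2) : bool * ptree unit :=
  (root_label (val t), spread (val t)).

(** [collect] recovers the tree from its code, except for the root label, which
    is part of the code. *)
Lemma coding_inj : injective coding.
Proof.
move=> t t' [Eb Es]; apply: val_inj.
have /andP[_ ok] := valP t; have /andP[_ ok'] := valP t'.
have E : relabel true (val t) = relabel true (val t').
  by rewrite -(spreadK ok) Es (spreadK ok').
by rewrite -[LHS](relabelK true) E Eb (relabelK true).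
Qed.

Lemma forest_spec bu : arity_ge2 bu.2 -> 1 < nleaves bu.2 ->
  [/\ ~~ nilp (forest bu), all (@arity_ge2 unit) (forest bu) &
    sumn (map (@nleaves unit) (forest bu)) = nleaves bu.2].
Proof.
case: bu => -[] u /= ok lt1; rewrite /forest /=; first by rewrite ok addn0.
by case: u ok lt1 => // -[] ts /andP[sz ?] _; split=> //=; case: (ts) sz.
Qed.

(** The size of the forest tells the label: one tree for 1, at least two for
    0. *)
Lemma forest_inj bu bu' : arity_ge2 bu.2 -> arity_ge2 bu'.2 ->
  1 < nleaves bu.2 -> 1 < nleaves bu'.2 ->
  forest bu = forest bu' -> bu = bu'.
Proof.
case: bu bu' => [[] u] [[] u'] //=; rewrite /forest /=.
- by move=> _ _ _ _ [->].
- by case: u' => // -[] [|v [|w ws]].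
- by case: u => // -[] [|v [|w ws]].
- by case: u => // -[] ts; case: u' => // -[] ts' _ _ _ _ /= ->.
Qed.

(** The bijection from decorated trees to nonempty Schroeder paths, which
    respects both degrees. *)
Definition to_path (t : Tinf2) : seq step := forest_path (forest (coding t)).

Lemma coding_ok t : arity_ge2 (coding t).2 /\
  nleaves (coding t).2 = (deg_angle t).+1.
Proof.
have /andP[_ ok] := valP t.
by split; [exact: (spread_arity ok) | exact: (nleaves_spread ok)].
Qed.

Lemma deg_angle_gt0 t : 0 < deg_angle t.
Proof.
case: t => -[|d ts] //= ok; rewrite /deg_angle /=.
have /andP[_ /andP[/node_okP[u [us [[_ us0 sz pos _] _]]] _]] := ok.
by case: (us) us0 sz; case: d.2 pos => // -[].
Qed.

Lemma to_path_inj : injective to_path.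
Proof.
move=> t t' E; apply: coding_inj.
have [ok n] := coding_ok t; have [ok' n'] := coding_ok t'.
have lt1 : 1 < nleaves (coding t).2 by rewrite n ltnS deg_angle_gt0.
have lt1' : 1 < nleaves (coding t').2 by rewrite n' ltnS deg_angle_gt0.
have [? ? _] := forest_spec ok lt1; have [? ? _] := forest_spec ok' lt1'.
by apply: forest_inj => //; apply: forest_path_inj.
Qed.

Lemma to_path_size t : [/\ schroder_path (deg_angle t) (to_path t) &
  count is_stepD (to_path t) + deg_node t = deg_angle t].
Proof.
have [ok n] := coding_ok t.
have lt1 : 1 < nleaves (coding t).2 by rewrite n ltnS deg_angle_gt0.
have [f0 fok fn] := forest_spec ok lt1.
split; first by apply: forest_path_schroder; rewrite // fn.
have [x _ d] := forest_path_size f0 fok.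
rewrite /deg_node -(internal_forest (valP t)) d; apply: succn_inj.
by rewrite x fn n.
Qed.

Lemma coding_surj b u : arity_ge2 u -> 1 < nleaves u ->
  exists t, coding t = (b, u).
Proof.
move=> ok lt1; have cok := relabel_ok b (collect_ok ok).
have nl : ~~ is_leaf (relabel b (collect u)).
  by case: u ok lt1 {cok} => // -[] [|v vs].
have tok : Tinf2_pred (relabel b (collect u)) by rewrite /Tinf2_pred nl cok.
exists (Sub _ tok); rewrite /coding /= -{3}(collectK ok).
by case: (collect u) nl => // -[].
Qed.

Lemma to_path_surj n p : 0 < n -> schroder_path n p -> exists t, to_path t = p.
Proof.
move=> n0 /forest_path_surj [ts [ts0 oks nl ->]].
suff [b [u [ok lt1 <-]]] : exists b u,
    [/\ arity_ge2 u, 1 < nleaves u & forest (b, u) = ts].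
  by have [t <-] := coding_surj b ok lt1; exists t.
case: ts ts0 oks nl => // u [|v vs] _ oks nl.
  exists true, u; move: oks nl => /= /andP[-> _]; rewrite addn0 => ->.
  by split.
exists false, (Node tt [:: u, v & vs]); split=> //=.
by move: nl => /= ->.
Qed.

Lemma image_deg_angle n : 0 < n ->
  to_path @` [set t | deg_angle t = n] = schroder_path n.
Proof.
move=> n0; apply/seteqP; split=> [_ [t <- <-]|p Sp].
  by case: (to_path_size t).
have [t Et] := to_path_surj n0 Sp; exists t => //=; subst p.
have [/schroder_pathE[x _ _] _] := to_path_size t.
by case/schroder_pathE: Sp => <-.
Qed.

Lemma image_hom n m : 0 < n -> m <= n -> to_path @` Tinf2_hom n m = SP n m.
Proof.
move=> n0 le_mn; apply/seteqP; split=> [_ [t [<- <-] <-]|p [Sp Dp]].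
  by have [S D] := to_path_size t; split=> //; lia.
move: (Sp); rewrite -image_deg_angle // => -[t nt Et]; exists t => //.
split=> //; have [_] := to_path_size t; rewrite Et Dp nt.
rewrite /= in nt *; lia.
Qed.

Lemma Tinf2_hom_card n m : 0 < n -> m <= n -> Tinf2_hom n m #= SP n m.
Proof.
move=> n0 le_mn; rewrite card_eq_sym -image_hom //.
by apply: inj_card_eq => t t' _ _; apply: to_path_inj.
Qed.

Lemma deg_angle_card n : 0 < n -> [set t | deg_angle t = n] #= schroder_path n.
Proof.
move=> n0; rewrite card_eq_sym -image_deg_angle //.
by apply: inj_card_eq => t t' _ _; apply: to_path_inj.
Qed.

Lemma coding_image n : 0 < n ->
  coding @` [set t | deg_angle t = n] = [set: bool] `*` PT n.
Proof.
move=> n0; apply/seteqP; split=> [_ [t <- <-]|[b u] [_ [/= ok nl]]].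
  by have [ok nl] := coding_ok t; split.
have [|t Et] := coding_surj b ok; first by rewrite nl.
exists t => //=; have [_] := coding_ok t; rewrite Et /= nl.
by move=> /succn_inj.
Qed.

Lemma deg_angle_card_bool_PT n : 0 < n ->
  [set t | deg_angle t = n] #= [set: bool] `*` PT n.
Proof.
move=> n0; rewrite card_eq_sym -coding_image //.
by apply: inj_card_eq => t t' _ _; apply: coding_inj.
Qed.

(** The factor 2 is the free choice of the root label. Finiteness comes from the
    bijection with Schroeder paths. *)
Lemma PT_deg_angle_card n : 0 < n ->
  exists p, PT n #= `I_p /\ [set t | deg_angle t = n] #= `I_(2 * p).
Proof.
move=> n0; have fin : finite_set ([set: bool] `*` PT n).
  rewrite -(eq_finite_set (deg_angle_card_bool_PT n0)).
  rewrite (eq_finite_set (deg_angle_card n0)).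
  exact: schroder_finite.
have finPT : finite_set (PT n).
  have -> : PT n = snd @` ([set: bool] `*` PT n).
    by apply/seteqP; split=> [u ?|_ [[b u] [_ ?] <-]] //; exists (true, u).
  exact: finite_image.
have [p Ep] := finPT; exists p; split=> //.
apply: card_eq_trans (deg_angle_card_bool_PT n0) _.
set us := fset_set (PT n).
have us_size : size us = p by exact: card_fset_set.
set bus := [seq (b, u) | b <- [:: true; false], u <- us].
have mem_bus bu : (bu \in bus) = (bu.2 \in us).
  apply/allpairsP/idP => [[bu' [_ us_u ->]] //|us_u].
  by exists bu; split=> //; [case: bu.1 | case: bu {us_u}].
have [A memA cardA] : exists2 A : {fset bool * ptree unit},
    forall bu, (bu \in A) = (bu.2 \in us) & #|` A| = 2 * p.
  exists [fset bu in bus]%fset => [bu|]; first by rewrite in_fset mem_bus.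
  rewrite card_fseq undup_id ?size_allpairs ?us_size //.
  by apply: allpairs_uniq => // -[b u] [b' u'] _ _ [-> ->].
have -> : [set: bool] `*` PT n = [set` A].
  apply/seteqP; split=> bu; rewrite /= memA in_fset_set //.
    by case=> _ /mem_set.
  by move/set_mem.
exact/card_eq_fsetP.
Qed.

(** * Ranks of spans of basis trees *)

Section Span.
Local Open Scope ring_scope.
Variables (k : comNzRingType) (M : lmodType k).
Implicit Types (S : set M).

Lemma sub_lspan S : S `<=` lspan S.
Proof.
move=> x Sx; exists 1%N, (fun=> 1), (fun=> x); split=> //.
by rewrite big_ord1 scale1r.
Qed.

Lemma lspan_mono S S' : S `<=` S' -> lspan S `<=` lspan S'.
Proof.
by move=> SS' x [p [c [v [Sv ->]]]]; exists p, c, v; split=> // i; apply: SS'.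
Qed.

Lemma lspanD S x y : lspan S x -> lspan S y -> lspan S (x + y).
Proof.
move=> [p [c [v [Sv ->]]]] [q [d [w [Sw ->]]]].
exists (p + q)%N,
  (fun i => match fintype.split i with inl i => c i | inr i => d i end),
  (fun i => match fintype.split i with inl i => v i | inr i => w i end).
split; first by move=> i; case: (fintype.split i).
rewrite big_split_ord /=; congr (_ + _); apply: eq_bigr => i _.
  by rewrite -[lshift q i]/(fintype.unsplit (inl i)) unsplitK.
by rewrite -[rshift p i]/(fintype.unsplit (inr i)) unsplitK.
Qed.

Lemma lspanZ S a x : lspan S x -> lspan S (a *: x).
Proof.
move=> [p [c [v [Sv ->]]]]; exists p, (fun i => a * c i), v; split=> //.
by rewrite scaler_sumr; apply: eq_bigr => i _; rewrite scalerA.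
Qed.

Lemma lspan0 S : lspan S 0.
Proof.
exists 0%N, (fun=> 0), (fun=> 0); rewrite big_ord0; split=> // -[] //.
Qed.

Lemma lspan_id S : lspan (lspan S) = lspan S.
Proof.
apply/seteqP; split; last exact/sub_lspan.
move=> _ [p [c [v [Sv ->]]]]; elim/big_ind: _ => [|x y|i _].
- exact: lspan0.
- exact: lspanD.
- exact/lspanZ/Sv.
Qed.

Lemma lspan_bigcup (I : Type) (D : set I) (F : I -> set M) :
  lspan (\bigcup_(i in D) lspan (F i)) = lspan (\bigcup_(i in D) F i).
Proof.
apply/seteqP; split.
  rewrite -[X in _ `<=` X]lspan_id; apply: lspan_mono => x [i Di Fx].
  by apply: lspan_mono Fx => y Fy; exists i.
by apply: lspan_mono => x [i Di Fx]; exists i => //; apply: sub_lspan.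
Qed.

End Span.

Section Basis.
Local Open Scope ring_scope.
Variable k : comNzRingType.

Lemma Binf2_basisE (t t' : Tinf2) :
  mcoeff t (Binf2_basis k t') = (t' == t)%:R.
Proof. exact: mcoeffU. Qed.

Lemma mcoeff_combination (p : nat) (c : 'I_p -> k) (v : 'I_p -> Binf2 k) t :
  mcoeff t (\sum_(i < p) c i *: v i) = \sum_(i < p) c i * mcoeff t (v i).
Proof.
apply: etrans (raddf_sum (@mcoeff Tinf2 k t) (index_enum 'I_p) predT
                 (fun i => c i *: v i : {malg k[Tinf2]})) _.
by apply: eq_bigr => i _; exact: mcoeffZ.
Qed.

Lemma Binf2_basis_inj : injective (@Binf2_basis k).
Proof.
move=> t t' /(congr1 (mcoeff t)) E.
have /eqP : (t == t)%:R = (t' == t)%:R :> k.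
  exact: etrans (esym (Binf2_basisE t t)) (etrans E (Binf2_basisE t t')).
have [//|ne] := eqVneq t' t.
by rewrite eqxx oner_eq0.
Qed.

Lemma Binf2_basis_free (S : set Tinf2) : lfree (@Binf2_basis k @` S).
Proof.
move=> p c v Sv inj_v sum0 i.
have /choice[t Et] : forall j, exists t, Binf2_basis k t = v j.
  by move=> j; have [t _] := Sv j; exists t.
have coef j : mcoeff (t i) (v j) = (j == i)%:R.
  rewrite -Et; apply: etrans (Binf2_basisE _ _) _.
  have [->|ne] := eqVneq j i; first by rewrite eqxx.
  case: eqP => // tji; case/eqP: ne; apply: inj_v.
  by rewrite -(Et i) -(Et j) tji.
have := congr1 (mcoeff (t i)) sum0.
move/(etrans (esym (mcoeff_combination _ _ _))).
rewrite (eq_bigr (fun j => c j * (j == i)%:R)); last by move=> j _; rewrite coef.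
rewrite (bigD1 i) //= big1 ?addr0 => [|j /negbTE->]; last by rewrite mulr0.
by rewrite eqxx mulr1 => ->; exact: mcoeff0.
Qed.

Lemma Binf2_basis_span (S : set Tinf2) :
  is_basis (@Binf2_basis k @` S) (lspan (@Binf2_basis k @` S)).
Proof. by split; first exact: Binf2_basis_free. Qed.

Lemma Binf2_basis_card (S : set Tinf2) : @Binf2_basis k @` S #= S.
Proof. by apply: inj_card_eq => t t' _ _; apply: Binf2_basis_inj. Qed.

Lemma Binf2_rank (S : set Tinf2) r :
  S #= `I_r -> has_rank (lspan (@Binf2_basis k @` S)) r.
Proof.
move=> Sr; exists (Binf2_basis k @` S); split; first exact: Binf2_basis_span.
exact: card_eq_trans (Binf2_basis_card S) Sr.
Qed.

(** Brings the sums of homogeneous components to the form required by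
    [Binf2_rank]. *)
Lemma Binf2_bigcup (D : set nat) (F : nat -> set Tinf2) :
  lspan (\bigcup_(i in D) lspan (@Binf2_basis k @` F i)) =
  lspan (@Binf2_basis k @` (\bigcup_(i in D) F i)).
Proof. by rewrite lspan_bigcup image_bigcup. Qed.

End Basis.

Theorem proposition3p8 (k : comNzRingType) (n m : nat) (hm : 1 <= m)
    (hmn : m <= n) :
  [/\ exists b : nat,
        [/\ has_rank (@Binf2_hom k n m) b,
            SP n m #= `I_b
          & b = catalan m * 'C(n + m, n - m)],
      exists p : nat,
        [/\ PT n #= `I_p,
            has_rank (@Binf2_angle k n) (2 * p)
          & large_schroder n (2 * p)]
    & has_infinite_rank (@Binf2_node k m)].
Proof.
have n0 : 0 < n := leq_trans hm hmn.
split.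
- exists (size (words (m + m + (n - m)) m m (n - m))); split.
  + exact/Binf2_rank/(card_eq_trans (Tinf2_hom_card n0 hmn))/SP_card.
  + exact: SP_card.
  + by rewrite size_words_diag; congr (_ * 'C(_, _)); lia.
- have [p [PTp Tp]] := PT_deg_angle_card n0; exists p; split=> //.
  + rewrite /Binf2_angle Binf2_bigcup.
    have -> : \bigcup_(m in [set: nat]) Tinf2_hom n m = [set t | deg_angle t = n].
      by apply/seteqP; split=> [t [? _ []]|t nt] //; exists (deg_node t).
    exact: Binf2_rank.
  + by apply: card_eq_trans Tp; rewrite card_eq_sym deg_angle_card.
- rewrite /Binf2_node Binf2_bigcup; set S := \bigcup_(i in _) _.
  exists (Binf2_basis k @` S); split; first exact: Binf2_basis_span.
  rewrite (eq_finite_set (Binf2_basis_card k S)) => finS.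
  suff : finite_set [set: nat] by apply: infinite_nat.
  (* Every j >= m is the angle degree of a tree of node degree m. *)
  apply: (@sub_finite_set _ _ (`I_m `|` deg_angle @` S)); last first.
    by rewrite finite_setU; split; [exact: finite_II | exact: finite_image].
  move=> j _; have [jm|mj] := ltnP j m; first by left.
  have j0 : 0 < j := leq_trans hm mj.
  right; have [t [jt mt]] : exists t, Tinf2_hom j m t.
    have size0 : 0 < size (words (m + m + (j - m)) m m (j - m)).
      have := @size_words _ m m (j - m) erefl (leqnSn m).
      by case: (size _) => // E; have := fact_gt0 (m + m + (j - m)); lia.
    case Ew : (words (m + m + (j - m)) m m (j - m)) size0 => [|p ws] // _.
    have : SP j m p by apply/mem_SP => //; rewrite Ew mem_head.
    by rewrite -image_hom // => -[t ? _]; exists t.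
  by exists t => //; exists j.
Qed.
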